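(* Let $n,d$ be positive integers and let $M=(m_{ij})\in\mathcal{M}(n,d)$. Suppose that the orbit $\mathbb{O}_M\subset\mathcal{F}_n^d\times\mathcal{F}_n^d$ is open. Then there exist sequences $1\le a_1\le\dots\le a_k\le n$ and $n\ge b_1\ge\dots\ge b_k\ge1$ such that $(a_i,b_i)\ne(a_{i+1},b_{i+1})$ for all $1\le i<k$, and $m_{ij}\ne0$ if and only if $(i,j)=(a_l,b_l)$ for some $1\le l\le k$.
   Context: Let $V=\mathbb{C}^d$, $G=GL(V)$, and let $\mathcal{F}_n^d$ be the variety of partial flags $\{0\}=U_0\subset U_1\subset\dots\subset U_n=V$ (all possible dimensions, inclusions not necessarily strict). $\mathcal{M}(n,d)$ is the set of $n\times n$ non-negative integer matrices with sum of entries $d$. The orbits of the diagonal $G$-action on $\mathcal{F}_n^d\times\mathcal{F}_n^d$ are $\mathbb{O}_M$, $M\in\mathcal{M}(n,d)$, where $(\mathbf{U},\mathbf{W})\in\mathbb{O}_M$ iff $\dim U_a\cap W_b=\sum_{i\le a,\,j\le b}m_{ij}$ for all $a,b$. *)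

(* Defs.v *)
From HB Require Import structures.
From mathcomp Require Import all_boot all_order all_algebra.
From mathcomp Require Import classical_sets reals complex mpoly.

Set Implicit Arguments.
Unset Strict Implicit.
Unset Printing Implicit Defensive.

Import GRing.Theory.
Local Open Scope ring_scope.

Section Flags.
Variables (R : realType) (n d : nat).
Local Notation C := R[i].
Local Notation V := 'rV[C]_d.

Definition is_flag (U : {ffun 'I_n.+1 -> {vspace V}}) : bool :=
  [&& U ord0 == 0%VS, U ord_max == fullv &
      [forall i : 'I_n, (U (widen_ord (leqnSn n) i) <= U (lift ord0 i))%VS]].

Definition flag := {U : {ffun 'I_n.+1 -> {vspace V}} | is_flag U}.

(* The homogeneous coordinates of the line \Lambda^{\dim U} U in P(\Lambda V),
   in the basis of \Lambda V indexed by the subsets of 'I_d.  This embeds the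
   disjoint union of the Grassmannians Gr(k, V), 0 <= k <= d, as a closed
   subset of a single projective space.  Choosing another basis of U rescales
   all the coordinates by a common nonzero factor. *)
Definition pluecker (U : {vspace V}) (I : {set 'I_d}) : C :=
  if #|I| == \dim U
  then \det (\matrix_(i < #|I|, j < #|I|) (vbasis U)`_i ord0 (enum_val j))
  else 0.

(* The product of two flag varieties is a closed subvariety of a product of
   2(n + 1) copies of P(\Lambda V): inl a is the copy containing the a-th
   subspace of the first flag, inr b that of the b-th subspace of the second. *)
Definition factor : finType := ('I_n.+1 + 'I_n.+1)%type.
Definition coordinate : finType := (factor * {set 'I_d})%type.

Definition multihomogeneous (f : {mpoly C[#|coordinate|]}) : Prop :=
  exists D : factor -> nat, forall m, m \in msupp f ->
    forall c : factor, (\sum_(I : {set 'I_d}) m (enum_rank (c, I)) = D c)%N.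

Definition subspace_at (x : flag * flag) (c : factor) : {vspace V} :=
  match c with inl a => val x.1 a | inr b => val x.2 b end.

Definition pluecker_point (x : flag * flag) : 'I_#|coordinate| -> C :=
  fun v => let cI := enum_val v in pluecker (subspace_at x cI.1) cI.2.

Definition zariski_closed (Z : set (flag * flag)) : Prop :=
  exists F : set {mpoly C[#|coordinate|]},
    (forall f, F f -> multihomogeneous f) /\
    (forall x, Z x <-> forall f, F f -> f.@[pluecker_point x] = 0).

Definition zariski_open (S : set (flag * flag)) : Prop :=
  zariski_closed (~` S)%classic.

(* Rows and columns of M are numbered from 0, so that i < a stands for the
   usual i <= a with i numbered from 1. *)
Definition orbit_of (M : 'M[nat]_n) : set (flag * flag) :=
  [set x : flag * flag | forall a b : 'I_n.+1,
     \dim (val x.1 a :&: val x.2 b)%VS =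
     (\sum_(i < n | i < a) \sum_(j < n | j < b) M i j)%N]%classic.

End Flags.

(* Main.v *)
Require Import Defs.
From mathcomp Require Import all_boot all_order all_algebra.
From mathcomp Require Import classical_sets reals complex mpoly.
From mathcomp Require Import zify.

(** If the support of M contained two positions (i, j) and (i', j') with i < i'
    and j < j', the orbit of M would not be open, because it can be left along
    an arbitrarily small deformation.  Distribute the vectors of the standard
    basis of V over the positions of M, m_ij of them at (i, j), so that e_k sits
    in row r k and column c k.  The flags U_a = <e_k : r k < a> and
    W_b = <e_k : c k < b> form a point of the orbit.  Choose e_k1 at (i, j) and
    e_k2 at (i', j'), and move the second flag by the transvection
    e_k1 |-> e_k1 + t e_k2.  For t <> 0 the image of e_k1 has left the
    intersection of the U and W that end with row i and column j, whose
    dimension drops, so the moved point is outside the orbit (it lies in the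
    orbit of the matrix with the 2 x 2 block of rows i, i' and columns j, j'
    changed by -1, +1, +1, -1).  At t = 0 it is inside [open_orbit_no_ascent].

    This contradicts openness by [zariski_closed_limit]: along a family of pairs
    of flags with bases polynomial in t, a closed set that contains all points
    with t <> 0 contains the point t = 0.  Indeed a multihomogeneous equation
    becomes, up to a nonzero factor, a polynomial in t with infinitely many
    zeros.

    A set of positions without such a pair is totally ordered by increasing row
    and decreasing column, and listing it in that order gives the two sequences
    [antitone_chain_enumeration]. *)

Set Implicit Arguments.
Unset Strict Implicit.
Unset Printing Implicit Defensive.

Import GRing.Theory Num.Theory.

(** * Zariski closed sets and polynomial curves *)

Section Curves.
Local Open Scope ring_scope.

(** The coordinates of the exterior product of the vectors of s.  They are
    taken over any ring in order to have them over polynomials in t, and are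
    defined for every I, as [pluecker] is, by 0 in the wrong degrees. *)
Definition minor (K : comNzRingType) d (s : seq 'rV[K]_d) (I : {set 'I_d}) : K :=
  if #|I| == size s
  then \det (\matrix_(i < #|I|, j < #|I|) s`_i ord0 (enum_val j))
  else 0.

Lemma map_minor (K L : comNzRingType) (f : {rmorphism K -> L}) d
    (s : seq 'rV[K]_d) (I : {set 'I_d}) :
  f (minor s I) = minor (map (map_mx f) s) I.
Proof.
rewrite /minor size_map; case: eqP => [sizeI|_]; last by rewrite rmorph0.
rewrite -det_map_mx; congr (\det _); apply/matrixP => i j; rewrite !mxE.
by rewrite (nth_map 0) ?mxE // -sizeI.
Qed.

Lemma size_basis_of (K : fieldType) (vT : vectType K) (U : {vspace vT})
    (X : seq vT) :
  basis_of U X -> size X = \dim U.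
Proof.
by move=> basisX; rewrite -(span_basis basisX) (eqP (basis_free basisX)).
Qed.

(** [pluecker] is computed in the arbitrary basis [vbasis]; this is what allows
    another basis to be used instead.  The factor c is the determinant of the
    change of basis, the same for all I. *)
Lemma minor_change_of_basis (K : fieldType) d (U : {vspace 'rV[K]_d})
    (X Y : seq 'rV[K]_d) :
  basis_of U X -> basis_of U Y ->
  exists2 c : K, c != 0 & forall I, minor Y I = c * minor X I.
Proof.
move=> basisX basisY.
have sizeX := size_basis_of basisX; have sizeY := size_basis_of basisY.
set m := \dim U in sizeX sizeY.
have [sX EX] : {s : m.-tuple 'rV[K]_d | X = s}.
  by exists (tcast sizeX (in_tuple X)); rewrite val_tcast.
have [sY EY] : {s : m.-tuple 'rV[K]_d | Y = s}.
  by exists (tcast sizeY (in_tuple Y)); rewrite val_tcast.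
subst X Y.
pose P := \matrix_(i < m, j < m) coord sX j sY`_i.
pose Q := \matrix_(i < m, j < m) coord sY j sX`_i.
have Y_in_X (i : 'I_m) : sY`_i = \sum_j P i j *: sX`_j.
  rewrite [LHS](coord_basis basisX); first by apply: eq_bigr => j _; rewrite mxE.
  by rewrite (basis_mem basisY) // mem_nth ?size_tuple.
have PQ1 : P *m Q = 1%:M.
  apply/matrixP => i k; rewrite !mxE -(coord_free i k (basis_free basisY)) Y_in_X.
  rewrite linear_sum; apply: eq_bigr => j _; rewrite linearZ /=.
  by rewrite [Q j k]mxE.
exists (\det P).
  have: P \in unitmx by case/mulmx1_unit: PQ1.
  by rewrite unitmxE unitfE.
move=> I; rewrite /minor !size_tuple.
case: eqP => [cardI|_]; last by rewrite mulr0.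
(* The columns e are made abstract so that #|I| can be replaced by m. *)
move: (@enum_val _ (mem I)); rewrite cardI => e.
rewrite -det_mulmx; congr (\det _); apply/matrixP => i k.
rewrite !mxE Y_in_X summxE; apply: eq_bigr => j _.
by rewrite !mxE.
Qed.

Lemma poly_eq0_nonzero (F : numFieldType) (p : {poly F}) :
  (forall t, t != 0 -> p.[t] = 0) -> p = 0.
Proof.
move=> p0; apply: (@roots_geq_poly_eq0 _ p [seq k.+1%:R | k <- iota 0 (size p)]).
- by apply/allP => _ /mapP[k _ ->]; apply/eqP/p0; rewrite pnatr_eq0.
- rewrite map_inj_uniq ?iota_uniq // => k l /eqP.
  by rewrite eqr_nat => /eqP[].
- by rewrite size_map size_iota.
Qed.

Section ProductOfFlags.
Variables (R : realType) (n d : nat).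
Local Notation C := R[i].

(** The vanishing of a multihomogeneous polynomial does not depend on the
    homogeneous coordinates chosen in each factor: rescaling factor c by
    lambda c multiplies the value by the product of the lambda c ^+ D c. *)
Lemma multihomogeneous_scale (f : {mpoly C[#|coordinate n d|]})
    (lambda : factor n -> C) (y : factor n * {set 'I_d} -> C) :
  multihomogeneous f -> (forall c, lambda c != 0) ->
  (f.@[fun v => lambda (enum_val v).1 * y (enum_val v)] == 0)
  = (f.@[fun v => y (enum_val v)] == 0).
Proof.
move=> [D homf] lambda0; pose mu := \prod_c lambda c ^+ D c.
have mu0 : mu != 0 by apply/prodf_neq0 => c _; rewrite expf_neq0.
suff -> : f.@[fun v => lambda (enum_val v).1 * y (enum_val v)]
          = mu * f.@[fun v => y (enum_val v)].
  by rewrite mulf_eq0 (negPf mu0).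
rewrite !mevalE mulr_sumr; apply: eq_big_seq => m /homf homm.
rewrite mulrCA; congr (_ * _).
under eq_bigr do rewrite exprMn; rewrite big_split /=; congr (_ * _).
rewrite (reindex (@enum_rank (coordinate n d))) /=; last first.
  by apply: onW_bij; apply: enum_rank_bij.
rewrite (eq_bigr (fun p => lambda p.1 ^+ m (enum_rank (p.1, p.2)))); last first.
  by case=> c I _; rewrite enum_rankK.
rewrite -(pair_bigA _ (fun c I => lambda c ^+ m (enum_rank (c, I)))) /=.
by apply: eq_bigr => c _; rewrite -(homm c) expr_sum.
Qed.

(** After replacing the Pluecker coordinates by the minors of the given bases,
    each equation of Z is a polynomial in t that vanishes for t != 0, hence is
    zero. *)
Lemma zariski_closed_limit (Z : set (flag R n d * flag R n d))
    (x : C -> flag R n d * flag R n d) (s : factor n -> seq 'rV[{poly C}]_d) :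
  zariski_closed Z ->
  (forall t c, basis_of (subspace_at (x t) c)
                        (map (map_mx (horner_eval t)) (s c))) ->
  (forall t, t != 0 -> Z (x t)) -> Z (x 0).
Proof.
move=> [F [homF ZF]] basis_s Zx; apply/ZF => f Ff.
pose p := \sum_(m <- msupp f) (f@_m)%:P *
  \prod_(v < #|coordinate n d|) minor (s (enum_val v).1) (enum_val v).2 ^+ m v.
suff pE t : (f.@[pluecker_point (x t)] == 0) = (p.[t] == 0).
  apply/eqP; rewrite pE (@poly_eq0_nonzero _ p) ?horner0 //.
  by move=> t t0; apply/eqP; rewrite -pE; apply/eqP; move/ZF: (Zx t t0); apply.
pose y c := minor (map (map_mx (horner_eval t)) (s c.1)) c.2.
have [lambda lambda0 lambdaE] : exists2 lambda : factor n -> C,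
    (forall c, lambda c != 0) &
    forall c I, pluecker (subspace_at (x t) c) I = lambda c * y (c, I).
  have scale c : exists l, (l != 0) &&
      [forall I, pluecker (subspace_at (x t) c) I == l * y (c, I)].
    have [l l0 lE] := minor_change_of_basis (basis_s t c) (vbasisP _).
    exists l; rewrite l0; apply/forallP => I; apply/eqP; rewrite -lE.
    by rewrite /pluecker /minor size_tuple.
  exists (fun c => xchoose (scale c)) => c.
    by case/andP: (xchooseP (scale c)).
  by move=> I; case/andP: (xchooseP (scale c)) => _ /forallP/(_ I)/eqP.
rewrite -(@multihomogeneous_scale f (fun c => (lambda c)^-1)
            (fun cI => pluecker (subspace_at (x t) cI.1) cI.2)).
- suff -> : p.[t] = f.@[fun v => y (enum_val v)].
    congr (_ == 0); apply: meval_eq => v.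
    by rewrite lambdaE mulKf // -surjective_pairing.
  rewrite mevalE horner_sum; apply: eq_bigr => m _.
  rewrite hornerM hornerC horner_prod; congr (_ * _); apply: eq_bigr => v _.
  by rewrite horner_exp /y -map_minor.
- exact: homF.
- by move=> c; rewrite invr_neq0.
Qed.

End ProductOfFlags.
End Curves.

(** * Flags spanned by rows of an invertible matrix *)

Section RowFlags.
Local Open Scope ring_scope.

Definition row_seq (K : nzRingType) d (g : 'M[K]_d) (A : {set 'I_d}) :=
  [seq row k g | k <- enum A].

Section RowSpan.
Variables (K : fieldType) (d : nat).
Implicit Types (g : 'M[K]_d) (A B : {set 'I_d}).

Definition row_span g A : {vspace 'rV[K]_d} := <<row_seq g A>>%VS.

Lemma free_row_seq g A : g \in unitmx -> free (row_seq g A).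
Proof.
move=> g_unit; pose X := map_tuple (fun k => row k g) (enum_tuple A).
suff: free X by []; apply/freeP => c sum0 j.
(* Multiplying by the inverse of g turns the rows of g into unit vectors. *)
have /(congr1 (fun v => (v *m invmx g) 0 (enum_val j))) := sum0.
rewrite mul0mx mulmx_suml summxE [RHS]mxE (bigD1 j) //= big1 ?addr0 => [|i i_neq_j].
  rewrite (nth_map (enum_val j)) -?cardE // -scalemxAl -row_mul mulmxV //.
  by rewrite -(enum_val_nth (enum_val j)) !mxE eqxx mulr1.
rewrite (nth_map (enum_val j)) -?cardE // -scalemxAl -row_mul mulmxV //.
rewrite -(enum_val_nth (enum_val j)) !mxE (inj_eq enum_val_inj).
by rewrite (negPf i_neq_j) mulr0.
Qed.

Lemma row_span_basis g A :
  g \in unitmx -> basis_of (row_span g A) (row_seq g A).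
Proof. by move=> g_unit; rewrite basisEfree free_row_seq // subvv dim_span. Qed.

Lemma dim_row_span g A : g \in unitmx -> \dim (row_span g A) = #|A|.
Proof.
move=> g_unit.
by rewrite -(size_basis_of (row_span_basis A g_unit)) size_map -cardE.
Qed.

(** The vector v *m invmx g lists the coordinates of v in the basis of the
    rows of g. *)
Lemma mem_row_span g A (v : 'rV[K]_d) : g \in unitmx ->
  reflect (forall k, k \notin A -> (v *m invmx g) 0 k = 0)
          (v \in row_span g A).
Proof.
move=> g_unit; apply: (iffP idP) => [|v0].
  rewrite /row_span span_def big_map big_enum /= => /memv_sumP[w w_line ->] k kA.
  rewrite mulmx_suml summxE big1 // => l lA.
  have /vlineP[c ->] := w_line l lA.
  rewrite -scalemxAl -row_mul mulmxV // !mxE.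
  by case: eqP lA kA => [-> ->|_ _ _] //; rewrite mulr0.
rewrite -[v](mulmxKV g_unit) mulmx_sum_row memv_suml // => k _.
have [kA|/v0->] := boolP (k \in A); last by rewrite scale0r mem0v.
by apply/memvZ/memv_span/map_f; rewrite mem_enum.
Qed.

Lemma mem_row_span1 A (v : 'rV[K]_d) :
  reflect (forall k, k \notin A -> v 0 k = 0) (v \in row_span 1%:M A).
Proof.
by have := mem_row_span A v (unitmx1 K d); rewrite invmx1 mulmx1.
Qed.

Lemma row_span1I A B :
  (row_span 1%:M A :&: row_span 1%:M B)%VS = row_span 1%:M (A :&: B).
Proof.
apply/vspaceP => v; rewrite memv_cap.
apply/andP/mem_row_span1 => [[/mem_row_span1 vA /mem_row_span1 vB] k|vAB].
  by rewrite inE negb_and => /orP[/vA|/vB].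
by split; apply/mem_row_span1 => k kA; rewrite vAB // inE (negPf kA) ?andbF.
Qed.

End RowSpan.

(** As vectors are rows and matrices act on the right, this maps e_k1 to
    e_k1 + t e_k2 and fixes the other e_k. *)
Definition transvection (K : comNzRingType) d (k1 k2 : 'I_d) (t : K) : 'M_d :=
  1%:M + t *: delta_mx k1 k2.

Lemma map_transvection (K L : comNzRingType) (f : {rmorphism K -> L}) d
    (k1 k2 : 'I_d) t :
  map_mx f (transvection k1 k2 t) = transvection k1 k2 (f t).
Proof. by rewrite map_mxD map_mx1 map_mxZ map_delta_mx. Qed.

Lemma transvectionK (K : comUnitRingType) d (k1 k2 : 'I_d) (t : K) : k1 != k2 ->
  transvection k1 k2 t *m transvection k1 k2 (- t) = 1%:M.
Proof.
move=> k12; rewrite /transvection mulmxDl !mulmxDr !mul1mx mulmx1.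
rewrite -scalemxAl -scalemxAr mul_delta_mx_0 1?eq_sym // !scaler0 addr0.
by rewrite scaleNr addrNK.
Qed.

Lemma transvection_unit (K : comUnitRingType) d (k1 k2 : 'I_d) (t : K) :
  k1 != k2 -> transvection k1 k2 t \in unitmx.
Proof. by move=> /(transvectionK t)/mulmx1_unit[]. Qed.

(** A vector of the transvected span of B with coordinate c at e_k1 has
    coordinate t c at e_k2; in the span of A the latter is 0, so c = 0.  When
    k1 belongs to A and B, the intersection has thus become smaller than the
    span of A :&: B. *)
Lemma transvection_cap (K : fieldType) d (A B : {set 'I_d}) (k1 k2 : 'I_d)
    (t : K) :
  k1 != k2 -> t != 0 -> k2 \notin A -> k2 \notin B ->
  (row_span 1%:M A :&: row_span (transvection k1 k2 t) B
     <= row_span 1%:M ((A :&: B) :\ k1))%VS.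
Proof.
move=> k12 t0 k2A k2B; apply/subvP => v /memv_capP[/mem_row_span1 vA].
have gu := transvection_unit t k12.
move=> /(mem_row_span _ _ gu).
have -> : invmx (transvection k1 k2 t) = transvection k1 k2 (- t).
  by rewrite -[LHS]mulmx1 -(transvectionK t k12) mulKmx.
have vgE k : (v *m transvection k1 k2 (- t)) 0 k
             = v 0 k - t * v 0 k1 * (k == k2)%:R.
  rewrite mulmxDr mulmx1 -scalemxAr !mxE; congr (_ + _).
  rewrite mulNr -mulrA; congr (- (_ * _)).
  rewrite (bigD1 k1) //= big1 => [|l lk].
    by rewrite !mxE eqxx addr0.
  by rewrite !mxE (negPf lk) mulr0.
move=> vB; apply/mem_row_span1 => k; rewrite !inE !negb_and negbK.
case/or3P => [/eqP->|/vA//|kB].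
  have := vB _ k2B; rewrite vgE eqxx (vA k2) // mulr1 sub0r => /eqP.
  by rewrite oppr_eq0 mulf_eq0 (negPf t0) => /eqP.
have := vB _ kB; rewrite vgE; have [->|_] := eqVneq k k2; first by rewrite vA.
by rewrite mulr0 subr0.
Qed.

Section Flags.
Variables (R : realType) (n d : nat).
Local Notation C := R[i].

Definition below (r : 'I_d -> 'I_n) (a : nat) : {set 'I_d} :=
  [set k | (r k < a)%N].

Lemma row_flag_subproof (g : 'M[C]_d) (r : 'I_d -> 'I_n) : g \in unitmx ->
  is_flag [ffun a : 'I_n.+1 => row_span g (below r a)].
Proof.
move=> g_unit; apply/and3P; split; last (apply/forallP => i); rewrite !ffunE.
- rewrite -dimv_eq0 dim_row_span // cards_eq0.
  by apply/eqP/setP => k; rewrite !inE.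
- rewrite -dimv_leqif_eq ?subvf // dim_row_span // dimvf /dim /= mul1n.
  rewrite -[X in _ == X]card_ord -cardsT; apply/eqP; congr #|pred_of_set _|.
  by apply/setP => k; rewrite !inE ltn_ord.
apply/span_subvP => v /mapP[k]; rewrite mem_enum inE /= => rk ->.
apply/memv_span/map_f; rewrite mem_enum inE /= /bump add1n.
exact: ltnW.
Qed.

Definition row_flag (g : 'M[C]_d) (r : 'I_d -> 'I_n) (g_unit : g \in unitmx) :
  flag R n d := exist (fun U => is_true (is_flag U)) _ (row_flag_subproof r g_unit).

End Flags.
End RowFlags.

(** * Open orbits *)

Section OpenOrbits.

(** This distributes the basis vectors e_k over the positions of M; f k is the
    pair of the row and the column of e_k. *)
Lemma matrix_fibers n d (M : 'M[nat]_n) :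
  \sum_(i < n) \sum_(j < n) M i j = d ->
  exists f : 'I_d -> 'I_n * 'I_n, forall p, \sum_(k | f k == p) 1 = M p.1 p.2.
Proof.
move=> sumM; pose T : finType := {p : 'I_n * 'I_n & 'I_(M p.1 p.2)}.
have cardT : #|T| = d.
  rewrite -sumM pair_bigA -sum1_card.
  rewrite -(sig_big_dep xpredT (fun _ => xpredT) (fun _ _ => 1)) /=.
  by apply: eq_bigr => p _; rewrite sum1_card card_ord.
exists (fun k => tag (enum_val (cast_ord (esym cardT) k))) => p.
rewrite (reindex (fun x : T => cast_ord cardT (enum_rank x))) /=; last first.
  apply: onW_bij; exists (fun k => enum_val (cast_ord (esym cardT) k)) => x.
    by rewrite cast_ordK enum_rankK.
  by rewrite enum_valK cast_ordKV.
under eq_bigl do rewrite cast_ordK enum_rankK.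
rewrite (eq_bigl (fun x : T => (tag x == p) && true)) => [|x]; last first.
  by rewrite andbT.
rewrite -(sig_big_dep (fun q => q == p) (fun _ => xpredT) (fun _ _ => 1)) /=.
by rewrite big_pred1_eq sum1_card card_ord.
Qed.

Lemma card_below n d (M : 'M[nat]_n) (f : 'I_d -> 'I_n * 'I_n) (a b : nat) :
  (forall p, \sum_(k | f k == p) 1 = M p.1 p.2) ->
  #|below (fun k => (f k).1) a :&: below (fun k => (f k).2) b|
  = \sum_(i < n | i < a) \sum_(j < n | j < b) M i j.
Proof.
move=> fibers; rewrite pair_big -sum1_card.
rewrite (partition_big f (fun p => (p.1 < a) && (p.2 < b))) /=; last first.
  by move=> k; rewrite !inE.
apply: eq_bigr => p pab; rewrite -fibers; apply: eq_bigl => k; rewrite !inE.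
by case: eqP => [->|]; rewrite ?andbF // pab.
Qed.

Local Open Scope ring_scope.

(** The point at t = 0 of the curve x below lies in the orbit, and the points
    with t != 0 lie in its complement, which is closed. *)
Lemma open_orbit_no_ascent (R : realType) (n d : nat) (M : 'M[nat]_n)
    (i j i' j' : 'I_n) :
  (\sum_(i < n) \sum_(j < n) M i j)%N = d -> zariski_open (@orbit_of R n d M) ->
  M i j != 0%N -> M i' j' != 0%N -> (i < i')%N -> (j < j')%N -> False.
Proof.
move=> sumM orbit_open Mij Mij' ii' jj'.
have [f fibers] := matrix_fibers sumM.
pose r k := (f k).1; pose c k := (f k).2.
have in_fiber p : M p.1 p.2 != 0%N -> exists k, f k = p.
  move=> Mp; have [k /eqP fk|no] := pickP (fun k => f k == p).
    by exists k.
  by rewrite -fibers big_pred0 in Mp.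
have [k1 fk1] := in_fiber (i, j) Mij; have [k2 fk2] := in_fiber (i', j') Mij'.
have k12 : k1 != k2.
  by apply/eqP => k12; move: fk2 ii'; rewrite -k12 fk1 => -[-> _]; rewrite ltnn.
pose x (t : R[i]) : flag R n d * flag R n d :=
  (row_flag r (unitmx1 _ d), row_flag c (transvection_unit t k12)).
pose s (e : factor n) : seq 'rV[{poly R[i]}]_d :=
  match e with
  | inl a => row_seq 1%:M (below r a)
  | inr b => row_seq (transvection k1 k2 'X) (below c b)
  end.
suff: ~ orbit_of M (x 0).
  apply=> a b; rewrite /= !ffunE -(card_below _ _ fibers).
  rewrite /transvection scale0r addr0 row_span1I.
  by rewrite dim_row_span ?unitmx1.
apply: (zariski_closed_limit (s := s) orbit_open) => [t e|t t0].
  have map_row_seq g A : [seq map_mx (horner_eval t) u | u <- row_seq g A]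
                         = row_seq (map_mx (horner_eval t) g) A.
    by rewrite /row_seq -map_comp; apply: eq_map => k /=; rewrite map_row.
  case: e => a /=; rewrite ffunE map_row_seq.
    by rewrite map_mx1; apply: row_span_basis; rewrite unitmx1.
  rewrite map_transvection /= /horner_eval hornerX.
  exact/row_span_basis/transvection_unit.
(* These indices have values i + 1 and j + 1: the two subspaces are the first
   ones to contain e_k1, and do not contain e_k2 yet. *)
move=> /(_ (lift ord0 i) (lift ord0 j)); rewrite /= !ffunE.
rewrite -(card_below _ _ fibers); apply/eqP; rewrite neq_ltn; apply/orP; left.
apply: leq_ltn_trans (dimvS (transvection_cap k12 t0 _ _)) _.
- by rewrite inE /r fk2 /= /bump add1n -leqNgt.
- by rewrite inE /c fk2 /= /bump add1n -leqNgt.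
rewrite dim_row_span ?unitmx1 // [ltnRHS](cardsD1 k1).
by rewrite !inE fk1 /= /bump !add1n !ltnSn.
Qed.

End OpenOrbits.

(** * Enumerating a set of positions without ascents *)

(** The relation leS below is a partial order on all positions, and the absence
    of ascents is exactly its totality on S; so S can be sorted by it. *)
Lemma antitone_chain_enumeration n (S : {set 'I_n * 'I_n}) :
  {in S &, forall p q : 'I_n * 'I_n, p.1 < q.1 -> p.2 < q.2 -> False} ->
  exists (k : nat) (a b : 'I_k -> 'I_n),
    [/\ forall l l' : 'I_k, l <= l' -> a l <= a l',
        forall l l' : 'I_k, l <= l' -> b l' <= b l,
        injective (fun l => (a l, b l)) &
        forall i j : 'I_n, (i, j) \in S <-> exists l : 'I_k, (i, j) = (a l, b l)].
Proof.
move=> no_ascent.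
pose leS := [rel p q : 'I_n * 'I_n | (p.1 <= q.1) && (q.2 <= p.2)].
have leS_trans : transitive leS.
  by move=> q p w /andP[pq1 pq2] /andP[qw1 qw2]; apply/andP; split; lia.
have leS_refl : reflexive leS by move=> p; rewrite /= !leqnn.
have leS_total : {in S &, total leS}.
  move=> p q pS qS; have := no_ascent p q pS qS; have := no_ascent q p qS pS.
  rewrite /=; case: (ltngtP p.1 q.1); case: (ltngtP p.2 q.2) => //= ? ? h1 h2.
    by case: h2.
  by case: h1.
pose s := sort leS (enum S).
have s_sorted : sorted leS s.
  by apply: (sort_sorted_in leS_total); apply/allP => p; rewrite mem_enum.
have s_mono (l l' : 'I_(size s)) : l <= l' ->
    leS (tnth (in_tuple s) l) (tnth (in_tuple s) l').
  move=> ll'; have p0 := tnth (in_tuple s) l; rewrite !(tnth_nth p0).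
  by apply: (sorted_leq_nth leS_trans leS_refl _ s_sorted); rewrite ?inE.
exists (size s), (fun l => (tnth (in_tuple s) l).1),
                 (fun l => (tnth (in_tuple s) l).2).
split.
- by move=> l l' /s_mono/andP[].
- by move=> l l' /s_mono/andP[].
- move=> l l'; rewrite -!surjective_pairing; apply/tuple_uniqP.
  by rewrite sort_uniq enum_uniq.
move=> i j; rewrite -mem_enum -(mem_sort leS) -/s.
split=> [/(tnthP (in_tuple s))[l ->]|[l ->]].
  by exists l; rewrite -surjective_pairing.
by rewrite -surjective_pairing mem_tnth.
Qed.

Theorem corollary2p10 (R : realType) (n d : nat) (M : 'M[nat]_n) :
  0 < n -> 0 < d ->
  \sum_(i < n) \sum_(j < n) M i j = d ->
  zariski_open (@orbit_of R n d M) ->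
  exists (k : nat) (a b : 'I_k -> 'I_n),
    [/\ forall l l' : 'I_k, l <= l' -> a l <= a l',
        forall l l' : 'I_k, l <= l' -> b l' <= b l,
        forall l l' : 'I_k, l' = l.+1 :> nat -> (a l, b l) <> (a l', b l') &
        forall i j : 'I_n, M i j <> 0 <-> exists l : 'I_k, (i, j) = (a l, b l)].
Proof.
move=> _ _ sumM orbit_open.
have [|k [a [b [a_mono b_mono ab_inj ab_support]]]] :=
    @antitone_chain_enumeration n [set p | M p.1 p.2 != 0].
  move=> p q; rewrite !inE => Mp Mq.
  exact: (open_orbit_no_ascent sumM orbit_open Mp Mq).
exists k, a, b; split=> // [l l' l'E|i j].
  by move=> /ab_inj ll'; move: l'E; rewrite ll' => /n_Sn.
by rewrite -ab_support inE /=; split=> /eqP.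
Qed.
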